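(* For every integer $g \geq 1$, the topological space $A^{\mathrm{tr}}_g$ (the moduli space of principally polarized tropical abelian varieties, defined in the context) is Hausdorff.
   Context: Let $\widetilde{S}^g_{\geq 0}$ be the set of $g\times g$ real positive semidefinite matrices whose kernel has a basis of vectors in $\mathbb{Q}^g$, viewed as a subset of $\mathbb{R}^{\binom{g+1}{2}}$ (one coordinate per diagonal or above-diagonal entry). $GL_g(\mathbb{Z})$ acts on the right by $Q\cdot X = X^TQX$. For $Q \in \widetilde{S}^g_{\geq 0}$, the Delone subdivision $\mathrm{Del}(Q)$ is the periodic polyhedral subdivision of $\mathbb{R}^g$ obtained by projecting (forgetting the last coordinate) the lower faces of the convex hull of $\{(x, x^TQx): x \in \mathbb{Z}^g\}\subset\mathbb{R}^{g+1}$. For a Delone subdivision $D$, let $\sigma_D = \{Q \in \widetilde{S}^g_{\geq 0}: \mathrm{Del}(Q) = D\}$, an open rational polyhedral cone, and let $\overline{\sigma_D}$ be its Euclidean closure (the secondary cone). It is known (Voronoi) that the secondary cones form a polyhedral fan with support $\widetilde{S}^g_{\geq 0}$, that $\sigma_D\cdot X=\sigma_{X^{-1}D}$ for $X\in GL_g(\mathbb{Z})$, and that there are finitely many $GL_g(\mathbb{Z})$-orbits of secondary cones. Let $\mathrm{Stab}(\sigma_D)=\{X\in GL_g(\mathbb{Z}): \sigma_D\cdot X=\sigma_D\}$, acting on $\overline{\sigma_D}$, and let $C(D)=\overline{\sigma_D}/\mathrm{Stab}(\sigma_D)$ (quotient topology). Choose Delone subdivisions $D_1,\dots,D_k$ such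 that $\overline{\sigma_{D_1}},\dots,\overline{\sigma_{D_k}}$ represent the $GL_g(\mathbb{Z})$-orbits of secondary cones. On $C(D_1)\sqcup\cdots\sqcup C(D_k)$ define $[Q_i]\sim[Q_j]$ (for $Q_i\in\overline{\sigma_{D_i}}$, $Q_j\in\overline{\sigma_{D_j}}$) iff $Q_j = X^TQ_iX$ for some $X \in GL_g(\mathbb{Z})$. Then $A^{\mathrm{tr}}_g = \left(C(D_1)\sqcup\cdots\sqcup C(D_k)\right)/\sim$ with the quotient topology. *)

(* Defs.v *)
From HB Require Import structures.
From mathcomp Require Import all_boot all_order all_algebra.
From mathcomp Require Import all_classical all_reals all_analysis.

Set Implicit Arguments.
Unset Strict Implicit.
Unset Printing Implicit Defensive.

Import Order.TTheory GRing.Theory Num.Theory.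
Import numFieldNormedType.Exports.

Local Open Scope classical_set_scope.
Local Open Scope ring_scope.
Local Open Scope quotient_scope.

Section Forms.
Context {R : realType} {g : nat}.
Implicit Types (Q : 'M[R]_g) (D : set (set 'cV[R]_g)) (X Y : 'M[int]_g).

Definition psd Q : Prop :=
  Q^T = Q /\ forall x : 'cV[R]_g, 0 <= (x^T *m Q *m x) 0 0.

(* [kermx A] has the row vectors [u] with [u *m A = 0] as row space, so the
   row space of [kermx Q^T] consists of the transposes of the solutions [x] of
   [Q *m x = 0]; the rows of [B] are the rational basis vectors. *)
Definition rational_kernel Q : Prop :=
  exists (r : nat) (B : 'M[rat]_(r, g)),
    row_free (map_mx (@ratr R) B) /\ (map_mx (@ratr R) B == kermx Q^T)%MS.

(* Symmetric matrices are kept inside the space of all matrices.  As they form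
   a closed linear subspace, on which the upper triangular entries are linear
   coordinates, topology and closure agree with those of R^(g(g+1)/2). *)
Definition rational_psd : set 'M[R]_g :=
  [set Q | psd Q /\ rational_kernel Q].

Definition convex_hull (V : lmodType R) (A : set V) : set V :=
  smallest [set B : set V | convex_set (B : set (convex_lmodType V))] A.

Definition lifted_lattice Q : set 'cV[R]_(g + 1) :=
  [set p | exists z : 'cV[int]_g,
     let x : 'cV[R]_g := map_mx intr z in p = col_mx x (x^T *m Q *m x)].

(* The faces whose inner normal has a positive last coordinate. *)
Definition lower_face (P F : set 'cV[R]_(g + 1)) : Prop :=
  F !=set0 /\
  exists2 a : 'cV[R]_(g + 1), 0 < (dsubmx a) 0 0 &
    F = [set p | P p /\ forall q, P q -> (a^T *m p) 0 0 <= (a^T *m q) 0 0].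

(* A subdivision of R^g is represented by the set of its (nonempty) cells of
   all dimensions; [usubmx] forgets the last coordinate. *)
Definition Del Q : set (set 'cV[R]_g) :=
  [set C | exists2 F, lower_face (convex_hull (lifted_lattice Q)) F &
     C = usubmx @` F].

Definition is_delone D : Prop := exists2 Q, rational_psd Q & Del Q = D.

Definition sigma D : set 'M[R]_g := [set Q | rational_psd Q /\ Del Q = D].

Definition secondary_cone D : set 'M[R]_g := closure (sigma D).

Definition GLZ : set 'M[int]_g := [set X | X \in unitmx].

Definition act X Q : 'M[R]_g :=
  (map_mx intr X)^T *m Q *m map_mx intr X.

Definition Stab D : set 'M[int]_g :=
  [set X | GLZ X /\ act X @` sigma D = sigma D].

Lemma act1 Q : act 1%:M Q = Q.
Proof. by rewrite /act map_mx1 trmx1 mul1mx mulmx1. Qed.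

Lemma actM X Y Q : act (X *m Y) Q = act Y (act X Q).
Proof. by rewrite /act map_mxM trmx_mul !mulmxA. Qed.

Lemma actK X Q : GLZ X -> act (invmx X) (act X Q) = Q.
Proof. by move=> Xu; rewrite -actM mulmxV// act1. Qed.

Lemma Stab1 D : Stab D 1%:M.
Proof.
split; first exact: unitmx1.
by apply/seteqP; split => [_ [Q DQ <-]|Q DQ]; [|exists Q]; rewrite ?act1.
Qed.

Lemma StabM D X Y : Stab D X -> Stab D Y -> Stab D (X *m Y).
Proof.
move=> [Xu XD] [Yu YD]; split; first by rewrite /GLZ/= unitmx_mul; apply/andP.
rewrite -[RHS]YD -[in RHS]XD image_comp.
by apply: eq_imagel => Q _; rewrite /= actM.
Qed.

Lemma StabV D X : Stab D X -> Stab D (invmx X).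
Proof.
move=> [Xu XD]; split; first by rewrite /GLZ/= unitmx_inv.
rewrite -[in LHS]XD image_comp -[RHS]image_id.
by apply: eq_imagel => Q _; rewrite /= actK.
Qed.

(* [C(D)], the quotient of the secondary cone by [Stab D]. *)
Definition stab_rel D (Q Q' : set_type (secondary_cone D)) : bool :=
  `[< exists2 X, Stab D X & val Q' = act X (val Q) >].

Lemma stab_rel_refl D : reflexive (@stab_rel D).
Proof.
by move=> Q; apply/asboolP; exists 1%:M; [exact: Stab1|rewrite act1].
Qed.

Lemma stab_rel_sym D : symmetric (@stab_rel D).
Proof.
suff H u v : @stab_rel D u v -> stab_rel v u.
  by move=> u v; apply/idP/idP; exact: H.
move=> /asboolP[X XD e]; apply/asboolP; exists (invmx X); first exact: StabV.
by rewrite e actK//; case: XD.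
Qed.

Lemma stab_rel_trans D : transitive (@stab_rel D).
Proof.
move=> Q2 Q1 Q3 /asboolP[X XD e] /asboolP[Y YD e']; apply/asboolP.
by exists (X *m Y); [exact: StabM|rewrite actM -e].
Qed.

Canonical stab_equiv D :=
  EquivRel (@stab_rel D) (@stab_rel_refl D) (@stab_rel_sym D)
    (@stab_rel_trans D).

Definition cone_quotient D : topologicalType :=
  quotient_topology {eq_quot (stab_equiv D)}.

Definition cone_class D (Q : set_type (secondary_cone D)) : cone_quotient D :=
  \pi_(quotient_topology {eq_quot (stab_equiv D)}) Q.

Lemma cone_class_eq D (Q Q' : set_type (secondary_cone D)) :
  cone_class Q = cone_class Q' -> exists2 X, Stab D X & val Q' = act X (val Q).
Proof.
move=> e; apply/asboolP.
exact: (introT (eqmodP (stab_equiv D) Q Q') e).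
Qed.

Lemma cone_class_surj D (p : cone_quotient D) : exists u, cone_class u = p.
Proof. by exists (repr p); exact: reprK. Qed.

End Forms.

Section Atr.
Context {R : realType} {g k : nat} (D : 'I_k -> set (set 'cV[R]_g)).

(* The cones of the [D i] contain exactly one member of each orbit. *)
Definition orbit_representatives : Prop :=
  (forall i, is_delone (D i)) /\
  forall D', is_delone D' ->
    exists! i, exists2 X, GLZ X &
      secondary_cone D' = act X @` secondary_cone (D i).

Definition cone_union : topologicalType := {i : 'I_k & cone_quotient (D i)}.

Definition atr_rel (p q : cone_union) : bool :=
  `[< exists (Q : set_type (secondary_cone (D (projT1 p))))
             (Q' : set_type (secondary_cone (D (projT1 q)))),
      [/\ projT2 p = cone_class Q, projT2 q = cone_class Q' &
          exists2 X, GLZ X & val Q' = act X (val Q)] >].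

Lemma atr_rel_refl : reflexive atr_rel.
Proof.
move=> p; apply/asboolP; have [Q eQ] := cone_class_surj (projT2 p).
exists Q, Q; split => //; exists 1%:M; last by rewrite act1.
exact: unitmx1.
Qed.

Lemma atr_rel_sym : symmetric atr_rel.
Proof.
suff H p q : atr_rel p q -> atr_rel q p.
  by move=> p q; apply/idP/idP; exact: H.
move=> /asboolP[Q [Q' [ep eq [X Xu e]]]]; apply/asboolP; exists Q', Q.
split => //; exists (invmx X); first by rewrite /GLZ/= unitmx_inv.
by rewrite e actK.
Qed.

Lemma atr_rel_trans : transitive atr_rel.
Proof.
move=> q p r /asboolP[Q1 [Q2 [ep eq [X Xu e]]]].
move=> /asboolP[Q2' [Q3 [eq' er [Y Yu e']]]]; apply/asboolP; exists Q1, Q3.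
split => //; have [Z [Zu _] eZ] := cone_class_eq (etrans (esym eq) eq').
exists (X *m (Z *m Y)); last by rewrite !actM -e -eZ.
by rewrite /GLZ/= !unitmx_mul Xu Zu.
Qed.

Canonical atr_equiv :=
  EquivRel atr_rel atr_rel_refl atr_rel_sym atr_rel_trans.

Definition Atr : topologicalType := quotient_topology {eq_quot atr_equiv}.

End Atr.

(* Main.v *)
(* For a form Q call a lattice vector minimal if it minimizes Q on its class
   modulo 2 Z^g.  A minimal y lies with 0 in a Delone cell, so the minimal
   vectors depend only on Del(Q); by continuity one bounded choice of minimal
   representatives serves a whole secondary cone.  For forms with such a
   bounded choice, Dirichlet approximation makes the minimal vectors, ordered
   by length, behave like a reduced basis: every minimal vector is bounded up
   to the kernel of Q.  If Q and X^T Q X both lie in secondary cones, X maps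
   minimal vectors of X^T Q X (among which one finds a matrix of odd
   determinant) to minimal vectors of Q, so only finitely many X matter.  Hence
   an equivalence class meets the cones in a finite set, and the saturation of
   a closed set is closed; disjoint neighbourhoods of two finite orbits then
   yield disjoint saturated ones. *)
Require Import Defs.
From mathcomp Require Import all_boot all_order all_algebra.
From mathcomp Require Import all_classical all_reals all_analysis.
From mathcomp Require Import ring lra zify.

Set Implicit Arguments.
Unset Strict Implicit.
Unset Printing Implicit Defensive.

Import Order.TTheory GRing.Theory Num.Theory.
Import numFieldNormedType.Exports.

Local Open Scope classical_set_scope.
Local Open Scope ring_scope.

(** * Quadratic forms and minimal vectors *)

Section QuadraticForms.
Context {R : realType} {g : nat}.
Implicit Types (Q : 'M[R]_g) (u v : 'cV[R]_g) (y z w : 'cV[int]_g).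

Definition real_vec z : 'cV[R]_g := map_mx intr z.

Lemma real_vec0 : real_vec 0 = 0. Proof. exact: map_mx0. Qed.
Lemma real_vecD y z : real_vec (y + z) = real_vec y + real_vec z.
Proof. exact: map_mxD. Qed.
Lemma real_vecN z : real_vec (- z) = - real_vec z.
Proof. exact: map_mxN. Qed.
Lemma real_vecB y z : real_vec (y - z) = real_vec y - real_vec z.
Proof. exact: map_mxB. Qed.
Lemma real_vecMn z n : real_vec (z *+ n) = n%:R *: real_vec z.
Proof. by rewrite /real_vec raddfMn/= scaler_nat. Qed.
Lemma real_vecZ (a : int) z : real_vec (a *: z) = a%:~R *: real_vec z.
Proof. exact: map_mxZ. Qed.

Lemma real_vecD2 y w : real_vec (y + w *+ 2) = real_vec y + 2 *: real_vec w.
Proof. by rewrite real_vecD real_vecMn. Qed.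

Definition bil Q u v : R := (u^T *m Q *m v) 0 0.
Definition qf Q u : R := bil Q u u.

Lemma bilDl Q u1 u2 v : bil Q (u1 + u2) v = bil Q u1 v + bil Q u2 v.
Proof. by rewrite /bil raddfD !mulmxDl mxE. Qed.
Lemma bilDr Q u v1 v2 : bil Q u (v1 + v2) = bil Q u v1 + bil Q u v2.
Proof. by rewrite /bil mulmxDr mxE. Qed.
Lemma bilZl Q a u v : bil Q (a *: u) v = a * bil Q u v.
Proof. by rewrite /bil linearZ -!scalemxAl mxE. Qed.
Lemma bilZr Q a u v : bil Q u (a *: v) = a * bil Q u v.
Proof. by rewrite /bil -scalemxAr mxE. Qed.
Lemma bilNl Q u v : bil Q (- u) v = - bil Q u v.
Proof. by rewrite -scaleN1r bilZl mulN1r. Qed.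
Lemma bilNr Q u v : bil Q u (- v) = - bil Q u v.
Proof. by rewrite -scaleN1r bilZr mulN1r. Qed.
Lemma bil0l Q v : bil Q 0 v = 0.
Proof. by rewrite -[X in bil _ X](scale0r 0) bilZl mul0r. Qed.
Lemma bil0r Q v : bil Q v 0 = 0.
Proof. by rewrite -[X in bil _ _ X](scale0r 0) bilZr mul0r. Qed.
Lemma bil_suml Q n (F : 'I_n -> 'cV[R]_g) v :
  bil Q (\sum_i F i) v = \sum_i bil Q (F i) v.
Proof.
by elim/big_ind2: _ => [|? ? ? ? <- <-|]//; rewrite ?bil0l ?bilDl.
Qed.
Lemma bil_sumr Q n (F : 'I_n -> 'cV[R]_g) v :
  bil Q v (\sum_i F i) = \sum_i bil Q v (F i).
Proof.
by elim/big_ind2: _ => [|? ? ? ? <- <-|]//; rewrite ?bil0r ?bilDr.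
Qed.
Definition bilE := (bilDl, bilDr, bilNl, bilNr, bilZl, bilZr).

Lemma qfZ Q a u : qf Q (a *: u) = a ^+ 2 * qf Q u.
Proof. by rewrite /qf !bilE mulrA. Qed.
Lemma qfN Q u : qf Q (- u) = qf Q u.
Proof. by rewrite /qf !bilE opprK. Qed.
Lemma qf0 Q : qf Q 0 = 0.
Proof. exact: bil0l. Qed.

Section Psd.
Variable (Q : 'M[R]_g).
Hypothesis Qpsd : psd Q.

Lemma bilC u v : bil Q u v = bil Q v u.
Proof.
have [sQ _] := Qpsd; rewrite /bil -[in LHS]sQ.
by rewrite -[in LHS](trmxK v) -!trmx_mul mxE mulmxA.
Qed.

Lemma qf_ge0 u : 0 <= qf Q u.
Proof. by have [_] := Qpsd; apply. Qed.

Lemma qfD u v : qf Q (u + v) = qf Q u + 2 * bil Q u v + qf Q v.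
Proof. by rewrite /qf !bilE (bilC v u); ring. Qed.
Lemma qfB u v : qf Q (u - v) = qf Q u - 2 * bil Q u v + qf Q v.
Proof. by rewrite /qf !bilE (bilC v u); ring. Qed.

Lemma qfD_le u v : qf Q (u + v) <= 2 * (qf Q u + qf Q v).
Proof. by have := qf_ge0 (u - v); rewrite qfB qfD; lra. Qed.

Lemma norm_bil_le u v : `|bil Q u v| <= (qf Q u + qf Q v) / 2.
Proof.
have := qf_ge0 (u - v); have := qf_ge0 (u + v); rewrite qfB qfD.
by move=> h1 h2; rewrite ler_norml; lra.
Qed.

Lemma qf_sum_le n (t : 'I_n -> R) (F : 'I_n -> 'cV[R]_g) (e M : R) :
  (forall i, `|t i| <= e) -> (forall i, qf Q (F i) <= M) ->
  qf Q (\sum_i t i *: F i) <= (n%:R * e) ^+ 2 * M.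
Proof.
move=> te FM; rewrite /qf bil_suml.
under eq_bigr do rewrite bil_sumr.
apply: (@le_trans _ _ (\sum_(i < n) \sum_(j < n) e ^+ 2 * M)).
  apply: ler_sum => i _; apply: ler_sum => j _.
  rewrite !bilE mulrA; apply: le_trans (ler_norm _) _.
  rewrite !normrM; apply: ler_pM => //.
    by rewrite expr2; apply: ler_pM.
  by apply: le_trans (norm_bil_le _ _) _; have := FM i; have := FM j; lra.
rewrite !sumr_const !card_ord -mulrnA -[_ *+ (n * n)]mulr_natl natrM.
by rewrite le_eqVlt; apply/orP; left; apply/eqP; ring.
Qed.

Lemma bil_eq0 u v : qf Q v = 0 -> bil Q u v = 0.
Proof.
move=> v0; have q0 := qf_ge0 u; set b := bil Q u v.
have q1 : 0 < qf Q u + 1 by lra.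
(* The [+ 1] keeps the denominator positive when [u] has norm zero too. *)
have := qf_ge0 ((b / (qf Q u + 1)) *: u - v).
rewrite qfB qfZ bilZl v0 addr0 -/b => h.
suff: b ^+ 2 * (qf Q u + 2) <= 0.
  rewrite pmulr_lle0; last by lra.
  by move=> b0; apply/eqP; rewrite -sqrf_eq0 eq_le b0 sqr_ge0.
have := mulr_ge0 h (sqr_ge0 (qf Q u + 1)).
suff -> : ((b / (qf Q u + 1)) ^+ 2 * qf Q u - 2 * (b / (qf Q u + 1) * b)) *
  (qf Q u + 1) ^+ 2 = - (b ^+ 2 * (qf Q u + 2)) by rewrite oppr_ge0.
by field; lra.
Qed.

Lemma mulmx_qf_eq0 v : qf Q v = 0 -> Q *m v = 0.
Proof.
move=> v0; apply/matrixP => i j; rewrite !ord1 [RHS]mxE.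
have := bil_eq0 (delta_mx i 0) v0.
by rewrite /bil -mulmxA trmx_delta -rowE mxE.
Qed.

End Psd.

Lemma qf_ker Q v : Q *m v = 0 -> qf Q v = 0.
Proof. by move=> e; rewrite /qf /bil -mulmxA e mulmx0 mxE. Qed.

Lemma qf_act Q X v :
  qf (act X Q) v = qf Q (map_mx intr X *m v).
Proof. by rewrite /qf /bil /act trmx_mul !mulmxA. Qed.

Definition minimal Q y : Prop :=
  forall w, qf Q (real_vec y) <= qf Q (real_vec (y + w *+ 2)).

(** Compare [y] with [y + 2 z] and [y - 2 z]. In this form minimality enters the estimates on
    chains. *)
Lemma minimal_bil Q y z : psd Q -> minimal Q y ->
  `|bil Q (real_vec y) (real_vec z)| <= qf Q (real_vec z).
Proof.
move=> Qpsd ymin; have := ymin z; have := ymin (- z).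
rewrite !real_vecD2 !qfD// !qfZ real_vecN !bilE qfN => h1 h2.
by rewrite ler_norml; lra.
Qed.

End QuadraticForms.

(** * Rational linear algebra with integral witnesses *)

Lemma common_denominator m n (A : 'M[rat]_(m, n)) :
  exists2 d : int, d != 0 &
    exists A' : 'M[int]_(m, n), d%:~R *: A = map_mx intr A'.
Proof.
exists (\prod_(p : 'I_m * 'I_n) denq (A p.1 p.2)).
  by apply/prodf_neq0 => p _; exact: denq_neq0.
exists (\matrix_(i, j) (numq (A i j) *
  \prod_(p : 'I_m * 'I_n | p != (i, j)) denq (A p.1 p.2))).
apply/matrixP => i j; rewrite !mxE (bigD1 (i, j))//= !rmorphM/= mulrAC.
congr (_ * _); rewrite -{2}(divq_num_den (A i j)) mulrC divfK//.
by rewrite intr_eq0 denq_neq0.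
Qed.

(** The alternative is decided over the rationals, where a separating functional can be cleared of
    denominators. Integrality of [phi] permits descent on its absolute value. *)
Lemma span_or_functional {R : realType} {g : nat} (s : seq 'cV[int]_g)
    (v : 'cV[int]_g) :
  (real_vec v \in <<[seq @real_vec R g y | y <- s]>>%VS) \/
  exists2 phi : 'rV[int]_g,
    (forall y, y \in s -> phi *m y = 0) & phi *m v != 0.
Proof.
pose q : 'cV[int]_g -> 'rV[rat]_g := fun z => map_mx intr z^T.
pose A : 'M[rat]_(size s, g) := \matrix_(i < size s) q s`_i.
have [/submxP[t vt]|nvA] := boolP (q v <= A)%MS.
  left; suff -> : real_vec v = \sum_(i < size s)
      ratr (t 0 i) *: @real_vec R g s`_i.
    apply: rpred_sum => i _; apply: rpredZ; apply: memv_span.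
    by apply: map_f; exact: mem_nth.
  apply/matrixP => j k; rewrite ord1 summxE !mxE.
  have := congr1 (fun x : 'rV[rat]_g => (ratr (x 0 j) : R)) vt.
  rewrite !mxE ratr_int => ->; rewrite rmorph_sum/=.
  by apply: eq_bigr => i _; rewrite !mxE rmorphM/= ratr_int.
right; have [j vj] : exists j, (q v *m cokermx A) 0 j != 0.
  apply/existsP; apply: contraR nvA => /existsPn h.
  rewrite submxE; apply/eqP/matrixP => i j; rewrite ord1 [RHS]mxE.
  by apply/eqP; move: (h j); rewrite negbK.
have [d d0 [c cE]] := common_denominator (col j (cokermx A))^T.
have ev z : ((c *m z) 0 0)%:~R = d%:~R * (q z *m cokermx A) 0 j.
  have -> : ((c *m z) 0 0)%:~R = (map_mx intr c *m map_mx intr z : 'M[rat]_1) 0 0.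
    by rewrite -map_mxM [RHS]mxE.
  rewrite -cE -scalemxAl mxE; congr (_ * _).
  rewrite -[map_mx intr z]trmxK -trmx_mul mxE map_trmx.
  by rewrite !mxE; apply: eq_bigr => i _; rewrite !mxE.
have c11 (x : 'M[int]_1) : ((x 0 0)%:~R == 0 :> rat) = (x == 0).
  rewrite intr_eq0; apply/eqP/eqP => [h|->]; last by rewrite mxE.
  by apply/matrixP => a b; rewrite !ord1 h mxE.
exists c => [y ys|].
  apply/eqP; rewrite -c11 ev.
  suff -> : q y *m cokermx A = 0 by rewrite mxE mulr0.
  have ilt : (index y s < size s)%N by rewrite index_mem.
  have -> : q y = row (Ordinal ilt) A by rewrite rowK/= nth_index.
  by rewrite -row_mul mulmx_coker row0.
by rewrite -c11 ev mulf_neq0// intr_eq0.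
Qed.

Section Boxes.
Variables m n : nat.

Definition int_box (B : nat) : seq 'M[int]_(m, n) :=
  [seq \matrix_(i, j) ((c i j : nat)%:Z - B%:Z) | c : 'M['I_(2 * B)%N.+1]_(m, n)].

Lemma mem_int_box B (z : 'M[int]_(m, n)) :
  (z \in int_box B) = [forall i, forall j, (absz (z i j) <= B)%N].
Proof.
apply/idP/'forall_'forall_idP => [/mapP[c _ ->] i j|h].
  by rewrite mxE; case: (c i j) => k kB /=; lia.
apply/mapP; exists (\matrix_(i, j) inord (absz (z i j + B%:Z))).
  by rewrite mem_enum.
apply/matrixP => i j; rewrite !mxE.
move: (z i j) (h i j : (absz (z i j) <= B)%N) => x xB; rewrite inordK; lia.
Qed.

Lemma int_boxS B C : (B <= C)%N -> {subset int_box B <= int_box C}.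
Proof.
move=> BC z; rewrite !mem_int_box => /'forall_'forall_idP h.
by apply/'forall_'forall_idP => i j; exact: leq_trans (h i j) BC.
Qed.

End Boxes.

(** * Forms with bounded minimal vectors *)

Section Reduced.
Context {R : realType} {g : nat}.
Implicit Types (Q : 'M[R]_g) (v w y z : 'cV[int]_g) (s : seq 'cV[int]_g).
Local Notation rv := (@real_vec R g).

(** [B] bounds one minimal vector in each class modulo 2; a degenerate form can have infinitely many
    others, translated along its kernel. *)
Definition reduced (B : nat) Q : Prop :=
  psd Q /\ forall z, exists2 y, y \in int_box _ _ B &
    minimal Q y /\ exists w, z = y + w *+ 2.

Lemma reducedS B C Q : (B <= C)%N -> reduced B Q -> reduced C Q.
Proof.
move=> BC [Qpsd h]; split=> // z; have [y yB ?] := h z; exists y => //.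
exact: int_boxS yB.
Qed.

Definition minimals B Q := [seq y <- int_box g 1 B | `[< minimal Q y >]].

(* A functional [phi] vanishing on the short minimal vectors vanishes on every
   short [z]: the congruent minimal vector [y] gives two short vectors
   [(z - y) / 2] and [(z + y) / 2], on both of which [phi] is [phi z / 2]. *)
Lemma reduced_span B Q v : reduced B Q ->
  rv v \in <<[seq rv y | y <- minimals B Q & (qf Q (rv y) <= qf Q (rv v))%R]>>%VS.
Proof.
move=> [Qpsd Qred]; set s := [seq y <- minimals B Q | qf Q (rv y) <= qf Q (rv v)].
have [//|[phi phi0 /eqP phiv]] := @span_or_functional R _ s v.
pose f z := (phi *m z) 0 0.
have feq0 z : f z = 0 -> phi *m z = 0.
  by move=> z0; apply/matrixP => i j; rewrite !ord1 [LHS]z0 mxE.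
suff H n z : qf Q (rv z) <= qf Q (rv v) -> (absz (f z) <= n)%N -> f z = 0.
  by case: phiv; apply: feq0; exact: (H (absz (f v))).
elim: n z => [|n IHn] z zv; first by rewrite leqn0 absz_eq0 => /eqP.
move=> zn; have [y yB [ymin [w zE]]] := Qred z.
have yz : qf Q (rv y) <= qf Q (rv z) by rewrite zE; exact: ymin.
have fy : phi *m y = 0.
  apply: phi0; rewrite mem_filter (le_trans yz zv) mem_filter yB andbT.
  exact/asboolP.
have fz : f z = f w *+ 2.
  by rewrite /f zE mulmxDr fy add0r mulr2n mulmxDr mxE -mulr2n.
have fw : f w = f (w + y) by rewrite /f mulmxDr fy addr0.
have [w0|w0] := eqVneq (f w) 0; first by rewrite fz w0 mul0rn.
have wn : (absz (f w) <= n)%N by move: zn w0; rewrite fz; lia.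
have v0 := qf_ge0 Qpsd (rv v).
(* By the parallelogram law the norms of [w] and [w + y] add up to half of those of [z] and [y], so
   at least one of the two is no longer than [v]. *)
have [wv|wv] := leP (qf Q (rv w)) (qf Q (rv v)).
  by rewrite fz (IHn w)// mul0rn.
rewrite fz fw (IHn (w + y)) ?mul0rn//; last by rewrite -fw.
move: zv yz wv; rewrite zE real_vecD2 real_vecD !qfD// qfZ !bilE.
by rewrite (bilC Qpsd (rv w)); lra.
Qed.

(** Indexing the coefficients by [nat] lets them shift when a vector is put in front of [s]. *)
Lemma span_coord s (f : 'cV[R]_g) : f \in <<[seq rv y | y <- s]>>%VS ->
  exists t : nat -> R, f = \sum_(i < size s) t i *: rv s`_i.
Proof.
move=> fs; pose X := in_tuple [seq rv y | y <- s].
exists (fun i => if insub i is Some j then coord X j f else 0).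
rewrite {1}(coord_span (X := X) fs); have e := size_map rv s.
rewrite (reindex (cast_ord (esym e)))/=; last first.
  by exists (cast_ord e) => i _; exact: val_inj.
apply: eq_bigr => i _; rewrite (nth_map 0)//; congr (_ *: _).
case: insubP => /= [j _ ji|/negP[]]; last by rewrite e.
by congr (coord _ _ _); exact: val_inj.
Qed.

End Reduced.

(** Pigeonhole: the fractional parts of the multiples of [tau] by [0, ..., M ^ n] fall into [M ^ n]
    cubes of side [1 / M], and [k] is the difference of two multipliers that share a cube. *)
Lemma dirichlet {R : realType} (n M : nat) (tau : 'I_n -> R) : (0 < M)%N ->
  exists2 k : nat, (0 < k <= M ^ n)%N &
    exists p : 'I_n -> int,
      forall i, `|k%:R * tau i - (p i)%:~R| <= M%:R^-1.
Proof.
case: M => // M _; have M0 : 0 < M.+1%:R :> R by [].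
pose frac (x : R) := x - (Num.floor x)%:~R.
have frac_itv x : 0 <= frac x < 1.
  by rewrite /frac; have := floor_itv x; rewrite rmorphD/= => /andP[]; lra.
pose c k : {ffun 'I_n -> 'I_M.+1} :=
  [ffun i => inord (Num.truncn (M.+1%:R * frac (k%:R * tau i)))].
have ltc x : (Num.truncn (M.+1%:R * frac x) < M.+1)%N.
  have /andP[f0 f1] := frac_itv x.
  rewrite -(ltr_nat R); apply: le_lt_trans (_ : M.+1%:R * frac x < _).
    by have /andP[] := truncn_itv (mulr_ge0 (ltW M0) f0).
  by rewrite -[ltRHS]mulr1 ltr_pM2l.
have /injectivePn[k [l]] : ~~ injectiveb (fun k : 'I_(M.+1 ^ n).+1 => c k).
  apply/injectiveP => /leq_card; rewrite card_ffun !card_ord.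
  by rewrite ltnn.
wlog kl : k l / (k < l)%N => [wl kl e|_ e].
  have : val k != val l by apply: contra_neq kl; exact: val_inj.
  by rewrite neq_ltn => /orP[] lt; [apply: wl e|apply: wl (esym e)];
    rewrite // eq_sym.
exists (l - k)%N; first by rewrite subn_gt0 kl/= -ltnS; have := ltn_ord l; lia.
exists (fun i => Num.floor (l%:R * tau i) - Num.floor (k%:R * tau i)) => i.
have := congr1 (fun f : {ffun 'I_n -> 'I_M.+1} => val (f i)) e.
rewrite !ffunE /= !inordK// => {}e.
have /andP[fk0 _] := frac_itv (k%:R * tau i).
have /andP[fl0 _] := frac_itv (l%:R * tau i).
have := truncn_itv (mulr_ge0 (ltW M0) fl0).
have := truncn_itv (mulr_ge0 (ltW M0) fk0); rewrite e.
set T := Num.truncn _; rewrite -[T.+1%:R]natr1 => /andP[k1 k2] /andP[l1 l2].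
rewrite natrB 1?ltnW// rmorphB/=.
have -> : (l%:R - k%:R) * tau i - ((Num.floor (l%:R * tau i))%:~R -
   (Num.floor (k%:R * tau i))%:~R) = frac (l%:R * tau i) - frac (k%:R * tau i).
  by rewrite /frac; ring.
rewrite -(ler_pM2l M0) mulfV// -{1}(gtr0_norm M0) -normrM ler_norml mulrBr.
by lra.
Qed.

(** * Reduced systems of minimal vectors *)

Section Chains.
Context {R : realType} {g : nat}.
Implicit Types (Q : 'M[R]_g) (v w y z : 'cV[int]_g) (s : seq 'cV[int]_g).
Implicit Types (f : 'cV[R]_g).
Local Notation rv := (@real_vec R g).
Local Notation spanZ s := <<[seq rv y | y <- s]>>%VS.

(** A substitute for a reduced basis, longest vector first: as with successive minima, every lattice
    vector strictly shorter than the head lies in the span of the tail. Linear dependences are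
    allowed. *)
Fixpoint chain Q s : Prop :=
  if s is y :: s' then
    [/\ minimal Q y, forall z, z \in s' -> qf Q (rv z) <= qf Q (rv y),
        forall v, qf Q (rv v) < qf Q (rv y) -> rv v \in spanZ s' &
        chain Q s']
  else True.

Lemma real_vec_sum n (F : 'I_n -> 'cV[int]_g) :
  rv (\sum_i F i) = \sum_i rv (F i).
Proof. exact: map_mx_sum. Qed.

Lemma round_comb s (t : nat -> R) : exists v, exists2 e : nat -> R,
  forall i, `|e i| <= 1 &
  rv v = \sum_(i < size s) t i *: rv s`_i - \sum_(i < size s) e i *: rv s`_i.
Proof.
exists (\sum_(i < size s) Num.floor (t i) *: s`_i).
exists (fun i => t i - (Num.floor (t i))%:~R) => [i|].
  by have := floor_itv (t i); rewrite rmorphD/= ler_norml => /andP[]; lra.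
rewrite real_vec_sum -sumrB; apply: eq_bigr => i _.
by rewrite real_vecZ -scalerBl subKr.
Qed.

Section Head.
Variables (Q : 'M[R]_g) (y : 'cV[int]_g) (s : seq 'cV[int]_g).
Hypotheses (Qpsd : psd Q) (ys : chain Q (y :: s)).

Let le_head i : qf Q (rv (y :: s)`_i) <= qf Q (rv y).
Proof.
have [_ hs _ _] := ys; case: i => //= i.
have [lt|ge] := ltnP i (size s); first by apply/hs/mem_nth.
by rewrite nth_default// real_vec0 qf0 (qf_ge0 Qpsd).
Qed.

(* Compare [bil Q f v] with [qf Q v] for a lattice vector [v] close to
   [f / (2 * A)]. *)
Lemma chain_qf_le f (A : R) : 0 < A -> f \in spanZ (y :: s) ->
  (forall v, `|bil Q f (rv v)| <= A * qf Q (rv v)) ->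
  qf Q f <= 4 * A ^+ 2 * (size s).+1%:R ^+ 2 * qf Q (rv y).
Proof.
move=> A0 fs fA; have [t ft] := span_coord fs.
have [v [e e1 vE]] := round_comb (y :: s) (fun i => t i / (2 * A)).
have := qf_sum_le Qpsd (fun i : 'I_(size (y :: s)) => e1 i)
  (fun i : 'I_(size (y :: s)) => le_head i).
move: vE; set d := \sum_(i < _) e i *: _.
rewrite (_ : \sum_(i < _) _ = (2 * A)^-1 *: f); last first.
  rewrite [in RHS]ft scaler_sumr; apply: eq_bigr => i _.
  by rewrite scalerA mulrC.
move=> vE; rewrite mulr1 => dle; have := le_trans (ler_norm _) (fA v).
rewrite vE qfB// qfZ !bilE -/(qf Q f) => h.
suff : qf Q f <= 4 * A ^+ 2 * qf Q d.
  move=> /le_trans; apply; rewrite -[leRHS]mulrA.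
  by apply: ler_wpM2l => //; rewrite mulr_ge0// sqr_ge0.
(* The scale [2 * A] is chosen so that the cross terms [bil Q f d] on the two sides of [h] cancel
   exactly. *)
have : (2 * A)^-1 * qf Q f <= A * ((2 * A)^-1 ^+ 2 * qf Q f + qf Q d).
  have : A * (2 * ((2 * A)^-1 * bil Q f d)) = bil Q f d by field; lra.
  by move: h; rewrite !mulrDr !mulrN; lra.
rewrite mulrDr => h2.
have e2 : A * ((2 * A)^-1 ^+ 2 * qf Q f) = (4 * A)^-1 * qf Q f.
  by field; lra.
have e3 : (2 * A)^-1 * qf Q f = 2 * ((4 * A)^-1 * qf Q f) by field; lra.
have h3 : (4 * A)^-1 * qf Q f <= A * qf Q d by move: h2; rewrite e2 e3; lra.
have A4 : 0 < 4 * A by lra.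
move: h3; rewrite -(ler_pM2l A4) mulrA mulfV ?gt_eqF// mul1r => /le_trans.
by apply; rewrite le_eqVlt; apply/orP; left; apply/eqP; ring.
Qed.

(* By simultaneous approximation some multiple [k * f / a] is close to a
   lattice vector outside the span of [s], whose norm is at least that of
   [y]. *)
Lemma chain_head_le (a : R) f1 (N := ((2 * (size s).+1) ^ size s)%N) :
  rv y \notin spanZ s -> f1 \in spanZ s ->
  a ^+ 2 * qf Q (rv y) <= 4 * N%:R ^+ 2 * qf Q (a *: rv y + f1).
Proof.
move=> ynot f1s; have [->|a0] := eqVneq a 0.
  by rewrite expr0n/= mul0r mulr_ge0 ?qf_ge0// mulr_ge0// sqr_ge0.
have [t ft] := span_coord f1s.
(* This modulus makes each rounding error at most [1 / (2 * (size s + 1))], so that [d] below has at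
   most a quarter of the norm of [y]. *)
have [k /andP[k0 kN] [p hp]] :=
  @dirichlet R (size s) (2 * (size s).+1) (fun i => t i / a) isT.
pose v := y *+ k + \sum_(i < size s) p i *: s`_i.
have sums (c : 'I_(size s) -> R) : \sum_i c i *: rv s`_i \in spanZ s.
  apply: rpred_sum => i _; apply/rpredZ/memv_span/map_f.
  exact: mem_nth.
have vE : rv v = k%:R *: rv y + \sum_(i < size s) (p i)%:~R *: rv s`_i.
  rewrite /v real_vecD real_vecMn real_vec_sum; congr (_ + _).
  by apply: eq_bigr => i _; rewrite real_vecZ.
have [_ _ hlt _] := ys.
have yv : qf Q (rv y) <= qf Q (rv v).
  rewrite leNgt; apply: contra ynot => /hlt.
  rewrite vE rpredDr; last exact: (sums (fun i => (p i)%:~R)).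
  by rewrite rpredZeq pnatr_eq0 -[k == 0%N]negbK -lt0n k0.
pose d := \sum_(i < size s) (k%:R * (t i / a) - (p i)%:~R) *: rv s`_i.
have vdE : rv v = (k%:R / a) *: (a *: rv y + f1) + - d.
  rewrite vE scalerDr scalerA divfK// -addrA; congr (_ + _).
  rewrite ft scaler_sumr -sumrB; apply: eq_bigr => i _.
  by rewrite scalerA -scalerBl; congr (_ *: _); field.
have dle : qf Q d <= 4^-1 * qf Q (rv y).
  have := qf_sum_le Qpsd hp (fun i : 'I_(size s) => le_head i.+1).
  move=> /= /le_trans; apply; apply: ler_wpM2r; first exact: qf_ge0.
  rewrite natrM invfM mulrCA exprMn.
  have -> : (4^-1 : R) = 2^-1 ^+ 2 * 1 by field.
  apply: ler_wpM2l; first exact: sqr_ge0.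
  rewrite expr_le1// ?divr_ge0// ler_pdivrMr// mul1r ler_nat.
  exact: leqnSn.
(* The contribution of [d] is at most half of [qf Q (rv y)] and is absorbed on the left. *)
have := qfD_le Qpsd ((k%:R / a) *: (a *: rv y + f1)) (- d).
rewrite -vdE qfN qfZ => h.
have kNR : k%:R ^+ 2 <= N%:R ^+ 2 :> R.
  by rewrite lerXn2r ?nnegrE// ler_nat.
have : qf Q (rv y) <= 4 * (k%:R / a) ^+ 2 * qf Q (a *: rv y + f1) by lra.
have a2 : 0 < a ^+ 2 by rewrite exprn_even_gt0.
rewrite -(ler_pM2l a2) => /le_trans; apply.
set q := qf Q (a *: _ + _).
have -> : a ^+ 2 * (4 * (k%:R / a) ^+ 2 * q) = k%:R ^+ 2 * (4 * q) by field.
have -> : 4 * N%:R ^+ 2 * q = N%:R ^+ 2 * (4 * q) by ring.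
by apply: ler_wpM2r => //; rewrite mulr_ge0// qf_ge0.
Qed.

End Head.

(** Induction on the length: the coefficient of the head is bounded, and what remains of [f]
    satisfies the same hypothesis with a larger [A]. The constant is uniform in [Q]; coefficients of
    vectors of norm zero cannot be controlled. *)
Lemma chain_coef_bound m (A : R) : 0 < A -> exists2 C : R, 0 <= C &
  forall Q s f, psd Q -> (size s <= m)%N -> chain Q s -> f \in spanZ s ->
    (forall v, `|bil Q f (rv v)| <= A * qf Q (rv v)) ->
  exists2 t : nat -> R, f = \sum_(i < size s) t i *: rv s`_i &
    forall i, (i < size s)%N -> `|t i| <= C \/ qf Q (rv s`_i) = 0.
Proof.
elim: m A => [|m IHm] A A0.
  exists 0 => // Q [|//] f _ _ _ fs _; exists (fun=> 0) => //.
  by rewrite big_ord0; move: fs; rewrite span_nil memv0 => /eqP.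
(* [c] is the square root of the product of the constants in [chain_head_le] and [chain_qf_le],
   taken at the largest length. *)
pose N : R := ((2 * m.+1) ^ m)%N%:R; pose c := 4 * N * A * m.+1%:R.
have c0 : 0 <= c by rewrite !mulr_ge0// ltW.
have Ac0 : 0 < A + c by lra.
have [C C0 hC] := IHm _ Ac0; exists (Num.max c C); first by rewrite le_max c0.
move=> Q [|y s] f Qpsd; first by move=> _ _ fs _; exists (fun=> 0) => //;
  rewrite big_ord0; move: fs; rewrite span_nil memv0 => /eqP.
rewrite ltnS => sm ys fs fA; have [ymin hs hlt chs] := ys.
(* If the longest vector has norm zero, so have all the others. *)
have [y0|yn0] := eqVneq (qf Q (rv y)) 0.
  have [t ft] := span_coord fs; exists t => // -[|i] /= ilt; right=> //.
  apply/eqP; rewrite eq_le (qf_ge0 Qpsd) andbT -y0; apply: hs.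
  exact: mem_nth.
have yp : 0 < qf Q (rv y) by rewrite lt0r yn0 qf_ge0.
(* A head already in the span of the tail gets coefficient 0; otherwise the two bounds on [qf Q f]
   are compared. *)
have [a [f1 f1s [fE ac]]] : exists a, exists2 f1, f1 \in spanZ s &
    f = a *: rv y + f1 /\ `|a| <= c.
  have [yin|ynot] := boolP (rv y \in spanZ s).
    exists 0, f; last by rewrite scale0r add0r normr0.
    move: fs; rewrite /= span_cons; apply: subvP.
    by rewrite subv_add subvv andbT -memvE.
  move: (fs); rewrite /= span_cons => /memv_addP[_ /vlineP[a ->] [f1 f1s fE]].
  exists a, f1 => //; split=> //.
  rewrite -(@ler_pXn2r _ 2)// ?nnegrE// real_normK ?num_real//.
  rewrite -(ler_pM2r yp); have := chain_head_le Qpsd ys a ynot f1s.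
  rewrite -fE; set n := (_ ^ _)%N => h1.
  have h2 := chain_qf_le Qpsd ys A0 fs fA.
  apply: le_trans h1 _; apply: le_trans (ler_wpM2l _ h2) _.
    by rewrite mulr_ge0// sqr_ge0.
  set q := qf Q (rv y); have -> : 4 * n%:R ^+ 2 * (4 * A ^+ 2 * (size s).+1%:R ^+ 2 * q) =
      (4 * n%:R * A * (size s).+1%:R) ^+ 2 * q by ring.
  apply: ler_wpM2r; first exact: ltW.
  have nN : n%:R <= N.
    rewrite ler_nat; apply: (@leq_trans ((2 * m.+1) ^ size s)%N).
      rewrite /n; have [->|s0] := posnP (size s); first by rewrite !expn0.
      by rewrite leq_exp2r// leq_mul2l.
    by rewrite leq_exp2l//; lia.
  have sM : (size s).+1%:R <= m.+1%:R :> R by rewrite ler_nat.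
  rewrite lerXn2r ?nnegrE ?mulr_ge0// ?(ltW A0)//.
  apply: ler_pM => //; first by rewrite !mulr_ge0// ltW.
  by apply: ler_wpM2r; [exact: ltW|apply: ler_wpM2l].
(* Since [y] is minimal, removing [a *: rv y] raises the constant by at most [c]. *)
have [v|t ft tC] := hC Q s f1 Qpsd sm chs f1s.
  have -> : f1 = f - a *: rv y by rewrite fE addrC addKr.
  rewrite !bilE mulrDl; apply: le_trans (ler_normB _ _) _.
  apply: lerD; first exact: fA.
  by rewrite normrM; apply: ler_pM => //; exact: minimal_bil.
exists (fun i => if i is j.+1 then t j else a).
  by rewrite big_ord_recl/= fE ft.
case=> [|i] /= ilt; first by left; rewrite le_max ac.
by have [tic|] := tC i ilt; [left; rewrite le_max tic orbT|right].
Qed.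

End Chains.

(** * Finiteness of equivalences between reduced forms *)

Section FiniteActions.
Context {R : realType} {g : nat}.
Implicit Types (Q : 'M[R]_g) (X Z : 'M[int]_g) (v w y z f : 'cV[int]_g).
Implicit Types (s : seq 'cV[int]_g) (B : nat).
Local Notation rv := (@real_vec R g).

Lemma reduced_chain B Q : reduced B Q ->
  exists2 s, chain Q s & perm_eq s (minimals B Q).
Proof.
move=> Qred; pose leQ y z := qf Q (rv z) <= qf Q (rv y).
have leQ_tot : total leQ by move=> y z; rewrite /leQ le_total.
have leQ_tr : transitive leQ.
  by move=> z y x; rewrite /leQ => h1 h2; exact: le_trans h2 h1.
exists (sort leQ (minimals B Q)); last by rewrite perm_sort.
have : sorted leQ (sort leQ (minimals B Q)) by exact: sort_sorted.
have : {subset sort leQ (minimals B Q) <= minimals B Q}.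
  by move=> y; rewrite mem_sort.
(* Invariant for the induction on suffixes: a suffix keeps every minimal vector strictly shorter
   than one of its members. With [reduced_span] it gives the span condition. *)
have : forall y z, y \in sort leQ (minimals B Q) -> z \in minimals B Q ->
    qf Q (rv z) < qf Q (rv y) -> z \in sort leQ (minimals B Q).
  by move=> y z _ zs _; rewrite mem_sort.
elim: (sort _ _) => //= y s IHs less sub; rewrite path_sortedE// => /andP[].
move=> /allP ley sorts.
have less' x z : x \in y :: s -> z \in minimals B Q ->
    qf Q (rv z) < qf Q (rv x) -> z \in s.
  move=> xs zs zx; have := less x z xs zs zx; rewrite inE => /predU1P[zy|//].
  move: zx; rewrite zy ltNge; move: xs; rewrite inE => /predU1P[->|/ley].
    by rewrite lexx.
  by rewrite /leQ => ->.
split.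
- have /sub : y \in y :: s by exact: mem_head.
  by rewrite mem_filter => /andP[/asboolP].
- exact: ley.
- move=> v vy; have := reduced_span v Qred; apply: subvP; apply: sub_span.
  move=> _ /mapP[z + ->]; rewrite mem_filter => /andP[zv zs]; apply: map_f.
  by apply: less' zs _; [exact: mem_head|exact: le_lt_trans zv vy].
- apply: IHs => //; last by move=> x xs; apply: sub; rewrite inE xs orbT.
  by move=> x z xs; apply: less'; rewrite inE xs orbT.
Qed.

(** Writing [f] in a chain, the coefficients are bounded except at vectors of norm zero, and those
    lie in the kernel of [Q]. *)
Lemma minimal_mod_kernel B : exists C : nat, forall Q f,
  reduced B Q -> minimal Q f ->
  exists2 f', f' \in int_box g 1 C & Q *m rv (f - f') = 0.
Proof.
pose m := size (int_box g 1 B).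
have [c c0 hc] := @chain_coef_bound R g m 1 ltr01.
exists (Num.bound (m%:R * ((c + 1) * B%:R))) => Q f Qred fmin.
have [Qpsd _] := Qred; have [s sch sperm] := reduced_chain Qred.
have sm : (size s <= m)%N.
  by rewrite (perm_size sperm) size_filter count_size.
have fs : rv f \in <<[seq rv y | y <- s]>>%VS.
  have := reduced_span f Qred; apply: subvP; apply: sub_span.
  move=> _ /mapP[z + ->]; rewrite mem_filter => /andP[_ zs]; apply: map_f.
  by rewrite (perm_mem sperm).
have fA v : `|bil Q (rv f) (rv v)| <= 1 * qf Q (rv v).
  by rewrite mul1r; exact: minimal_bil.
have [t ft tc] := hc Q s (rv f) Qpsd sm sch fs fA.
(* Only integral parts are removed, so [f'] remains a lattice vector while all its coefficients
   become bounded. *)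
pose k i := if qf Q (rv s`_i) == 0 then Num.floor (t i) else 0.
pose f' := f - \sum_(i < size s) k i *: s`_i.
have f'E : rv f' = \sum_(i < size s) (t i - (k i)%:~R) *: rv s`_i.
  rewrite /f' real_vecB ft real_vec_sum -sumrB; apply: eq_bigr => i _.
  by rewrite real_vecZ scalerBl.
exists f'; last first.
  rewrite /f' opprB addrC subrK real_vec_sum mulmx_sumr big1// => i _.
  rewrite real_vecZ -scalemxAr /k; case: eqP => [s0|_]; last by rewrite scale0r.
  by rewrite (mulmx_qf_eq0 Qpsd s0) scaler0.
have tk (i : 'I_(size s)) : `|t i - (k i)%:~R| <= c + 1.
  rewrite /k; case: eqP => [_|s0].
    by have := floor_itv (t i); rewrite rmorphD/= ler_norml => /andP[]; lra.
  by rewrite subr0; have [|//] := tc i (ltn_ord i); lra.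
rewrite mem_int_box; apply/'forall_'forall_idP => i j.
have hM : 0 <= m%:R * ((c + 1) * B%:R) :> R.
  by rewrite !mulr_ge0//; lra.
rewrite -(ler_nat R); apply: le_trans (ltW (archi_boundP hM)).
have -> : (absz (f' i j))%:R = `|rv f' i j|.
  by rewrite [in RHS]mxE -intr_norm -abszE.
rewrite f'E summxE; apply: le_trans (ler_norm_sum _ _ _) _.
apply: (@le_trans _ _ (\sum_(l < size s) (c + 1) * B%:R)).
  apply: ler_sum => l _; rewrite mxE normrM; apply: ler_pM => //.
  have : s`_l \in int_box g 1 B.
    have : s`_l \in minimals B Q by rewrite -(perm_mem sperm) mem_nth.
    by rewrite mem_filter => /andP[].
  rewrite mem_int_box => /'forall_'forall_idP/(_ i j).
  by rewrite mxE -intr_norm -abszE -(ler_nat R).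
rewrite sumr_const card_ord -[_ *+ size s]mulr_natl; apply: ler_wpM2r.
  by rewrite mulr_ge0//; lra.
by rewrite ler_nat.
Qed.

(** One realizer is chosen for each realizable [t]; this turns finitely many invariants into
    finitely many group elements. *)
Lemma finite_representatives (A T : eqType) (ts : seq T) (P : A -> T -> Prop) :
  exists2 l : seq A, (forall a, a \in l -> exists t, P a t) &
    forall a t, t \in ts -> P a t -> exists2 b, b \in l & P b t.
Proof.
elim: ts => [|t ts [l lP hl]]; first by exists [::].
have [[a Pat]|nPt] := pselect (exists a, P a t); last first.
  exists l => // b u; rewrite inE => /predU1P[->|uts] Pbu; last exact: hl Pbu.
  by case: nPt; exists b.
exists (a :: l) => [b|b u]; rewrite inE => /predU1P[->|h].
- by exists t.
- exact: lP.
- by move=> _; exists a; rewrite ?mem_head.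
- by move=> /(hl _ _ h)[d dl Pdu]; exists d; rewrite // inE dl orbT.
Qed.

Lemma minimal_act Q X y : GLZ X -> minimal (act X Q) y -> minimal Q (X *m y).
Proof.
move=> Xu ymin w; have := ymin (invmx X *m w).
rewrite !qf_act -!map_mxM mulmxDr.
suff -> : X *m ((invmx X *m w) *+ 2) = w *+ 2 by [].
by rewrite !mulr2n mulmxDr mulKVmx.
Qed.

(** Modulo 2 the determinant is 1. This applies to the matrix of minimal representatives of the unit
    vectors. *)
Lemma det_odd_neq0 (w u : 'M[int]_g) : 1%:M = w + u *+ 2 -> \det w != 0.
Proof.
move=> e; apply/eqP => w0.
have : \det (map_mx (intr : int -> 'F_2) (1%:M : 'M[int]_g)) = 1.
  by rewrite map_mx1 det1.
have -> : map_mx (intr : int -> 'F_2) (1%:M : 'M[int]_g) = map_mx intr w.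
  rewrite e raddfD/= raddfMn/= [X in _ + X](_ : _ = 0) ?addr0//.
  by apply/matrixP => i j; rewrite mulmxnE !mxE -mulr_natr char_Fp_0 ?mulr0.
by rewrite det_map_mx w0.
Qed.

Lemma real_mx_unit (w : 'M[int]_g) : \det w != 0 ->
  (map_mx intr w : 'M[R]_g) \in unitmx.
Proof. by rewrite unitmxE det_map_mx unitfE intr_eq0. Qed.

Lemma mulmx_col0P Q (M : 'M[int]_g) :
  Q *m map_mx intr M = 0 <-> forall j, Q *m rv (col j M) = 0.
Proof.
have e j : Q *m rv (col j M) = col j (Q *m map_mx intr M).
  by rewrite /real_vec map_col !colE mulmxA.
split=> [M0 j|M0]; first by rewrite e M0 col0.
by apply/matrixP => i j; have /matrixP/(_ i 0) := M0 j; rewrite e !mxE.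
Qed.

(* The coordinates [w] and [f] determine [X] up to the kernel of [Q], and this
   kernel is determined by the vectors of the box that it contains. *)
Lemma act_finite B : exists2 L : seq 'M[int]_g, (forall Z, Z \in L -> GLZ Z) &
  forall Q X, reduced B Q -> GLZ X -> reduced B (act X Q) ->
    exists2 Z, Z \in L & act Z Q = act X Q.
Proof.
have [C hC] := minimal_mod_kernel B.
pose kers Q := [seq y <- minimals B Q | qf Q (rv y) == 0].
pose P (QX : 'M[R]_g * 'M[int]_g) (t : 'M[int]_g * 'M[int]_g * seq 'cV[int]_g) :=
  [/\ reduced B QX.1, GLZ QX.2, \det t.1.1 != 0,
    QX.1 *m map_mx intr (QX.2 *m t.1.1 - t.1.2) = 0 & kers QX.1 = t.2].
pose box := int_box g 1 B.
pose ts := [seq (wf, mask (m : (size box).-tuple bool) box) |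
  wf <- [seq (W, F) | W <- int_box g g B, F <- int_box g g C],
  m <- enum {: (size box).-tuple bool}].
have [l lP hl] := finite_representatives ts P.
exists [seq QX.2 | QX <- l] => [_ /mapP[QX /lP[t [_ Xu _ _ _]] ->]//|].
move=> Q X Qred Xu Q'red; have [Qpsd _] := Qred; have [_ Q'min] := Q'red.
have /choice[y hy] : forall i : 'I_g, exists yi : 'cV[int]_g,
    [/\ yi \in int_box g 1 B, minimal (act X Q) yi &
      exists w, delta_mx i 0 = yi + w *+ 2].
  by move=> i; have [yi yB [ymin h]] := Q'min (delta_mx i 0); exists yi.
have /choice[u hu] : forall i : 'I_g, exists u : 'cV[int]_g,
    delta_mx i 0 = y i + u *+ 2 by move=> i; have [_ _] := hy i.
have /choice[f hf] : forall i : 'I_g, exists f : 'cV[int]_g,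
    f \in int_box g 1 C /\ Q *m rv (X *m y i - f) = 0.
  move=> i; have [_ ymin _] := hy i.
  by have [f fC fE] := hC Q _ Qred (minimal_act Xu ymin); exists f.
pose w : 'M[int]_g := \matrix_(i, j) y j i 0.
pose F : 'M[int]_g := \matrix_(i, j) f j i 0.
have colw j : col j w = y j by apply/matrixP => i k; rewrite !mxE ord1.
have colF j : col j F = f j by apply/matrixP => i k; rewrite !mxE ord1.
have w0 : \det w != 0.
  apply: (@det_odd_neq0 w (\matrix_(i, j) u j i 0)).
  apply/matrixP => i j; have /matrixP/(_ i 0) := hu j.
  by rewrite !(mulmxnE, mxE) eqxx andbT eq_sym => ->.
pose K := kers Q.
have tin : ((w, F), K) \in ts.
  pose p z := (qf Q (rv z) == 0) && `[< minimal Q z >].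
  apply/allpairsP; exists ((w, F), map_tuple p (in_tuple box)) => /=.
  split; last by rewrite /K /kers /minimals -filter_predI filter_mask.
    apply/allpairsP; exists (w, F) => /=.
    split=> //; rewrite mem_int_box; apply/'forall_'forall_idP => i j.
      have [+ _ _] := hy j; rewrite mem_int_box mxE.
      by move/'forall_'forall_idP/(_ i 0).
    have [+ _] := hf j; rewrite mem_int_box mxE.
    by move/'forall_'forall_idP/(_ i 0).
  by rewrite mem_enum.
have XwF : Q *m map_mx intr (X *m w - F) = 0.
  apply/mulmx_col0P => j; have [_] := hf j.
  by rewrite raddfB/= colF colE -mulmxA -colE colw.
have [[Q0 X0] QXl] : exists2 QX, QX \in l & P QX ((w, F), K).
  by apply: (hl (Q, X)).
move=> [/= Q0red X0u _ Q0E KE].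
exists X0; first by apply/mapP; exists (Q0, X0).
have [Q0psd _] := Q0red.
(* The columns lie in the kernel of [Q0]; [reduced_span] at norm zero puts them in the span of
   [kers Q0], which equals [kers Q]. *)
have X0E : Q *m map_mx intr (X0 *m w - F) = 0.
  apply/mulmx_col0P => j; set k := col j _.
  have Q0k : qf Q0 (rv k) = 0 by apply: qf_ker; exact: (mulmx_col0P _ _).1.
  have : rv k \in lker (linfun (mulmx Q : 'cV[R]_g -> 'cV[R]_g)).
    have := reduced_span k Q0red; apply: subvP; apply/span_subvP.
    move=> _ /mapP[z + ->]; rewrite mem_filter Q0k => /andP[z0 zm].
    have : z \in K.
      by rewrite -KE mem_filter zm andbT eq_le z0 qf_ge0.
    rewrite mem_filter => /andP[/eqP/(mulmx_qf_eq0 Qpsd) Qz _].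
    by rewrite memv_ker lfunE/= Qz.
  by rewrite memv_ker lfunE/= => /eqP.
have QX : Q *m map_mx intr X0 = Q *m map_mx intr X.
  apply/(can_inj (mulmxK (real_mx_unit w0))).
  apply/eqP; rewrite -subr_eq0 -!mulmxA -!map_mxM -mulmxBr -map_mxB.
  have -> : X0 *m w - X *m w = (X0 *m w - F) - (X *m w - F).
    by rewrite opprB addrA subrK.
  by rewrite map_mxB mulmxBr X0E XwF subrr.
have [sQ _] := Qpsd.
rewrite /act -[LHS]mulmxA QX mulmxA -[in LHS]sQ -trmx_mul QX trmx_mul sQ.
by [].
Qed.

End FiniteActions.

(** * Delone subdivisions and minimal vectors *)

Section Minimizers.
Context {R : realType} {g : nat}.
Implicit Types (Q : 'M[R]_g) (v w y z : 'cV[int]_g).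
Local Notation rv := (@real_vec R g).

Lemma seq_argmin (T : eqType) (F : T -> R) (l : seq T) x : x \in l ->
  exists2 y : T, y \in l & forall z : T, z \in l -> F y <= F z.
Proof.
elim: l x => // a l IHl x _; have [->|] := eqVneq l [::].
  by exists a; rewrite ?mem_head// => z; rewrite inE => /eqP ->.
case: l IHl => // b l IHl _; have [y yl ymin] := IHl b (mem_head _ _).
have [ay|ya] := leP (F a) (F y).
  exists a; rewrite ?mem_head// => z; rewrite inE => /predU1P[->//|/ymin].
  exact: le_trans.
exists y; first by rewrite inE yl orbT.
by move=> z; rewrite inE => /predU1P[->|/ymin//]; exact: ltW.
Qed.

Lemma qf_mul_tr r (P : 'M[R]_(g, r)) (x : 'cV[R]_g) :
  qf (P *m P^T) x = \sum_i (P^T *m x) i 0 ^+ 2.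
Proof.
rewrite /qf /bil mulmxA -mulmxA -[in x^T *m P](trmxK P) -trmx_mul mxE.
by apply: eq_bigr => i _; rewrite mxE expr2.
Qed.

(** Adding [P *m P^T] to [Q] makes it positive definite, and [y] is recovered from [S *m y], whose
    entries are bounded by [norm_bil_le]. *)
Lemma sublevel_bound Q r (P : 'M[R]_(g, r)) (M : R) : psd Q ->
  (forall x : 'cV[R]_g, Q *m x = 0 -> P^T *m x = 0 -> x = 0) ->
  exists C, forall y, qf Q (rv y) <= M ->
    (forall i, `|(P^T *m rv y) i 0| <= 2) -> y \in int_box g 1 C.
Proof.
move=> Qpsd inj; pose S := Q + P *m P^T.
have qS x : qf S x = qf Q x + \sum_i (P^T *m x) i 0 ^+ 2.
  by rewrite -qf_mul_tr /qf /bil /S mulmxDr mulmxDl mxE.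
have Spsd : psd S.
  have [sQ _] := Qpsd; split; first by rewrite /S raddfD/= sQ trmx_mul trmxK.
  move=> x; rewrite -/(bil S x x) -/(qf S x) qS addr_ge0 ?qf_ge0//.
  by apply: sumr_ge0 => i _; exact: sqr_ge0.
have Su : S \in unitmx.
  rewrite -row_free_unit -kermx_eq0; apply/eqP/row_matrixP => i.
  rewrite row0; set k := row i _.
  have kS : S *m k^T = 0.
    have [sS _] := Spsd; rewrite -sS -trmx_mul.
    by have /sub_kermxP -> : (k <= kermx S)%MS by [exact: row_sub]; rewrite trmx0.
  have := qf_ker kS; rewrite qS => /eqP; rewrite paddr_eq0 ?qf_ge0//; last first.
    by apply: sumr_ge0 => j _; exact: sqr_ge0.
  move=> /andP[/eqP k0]; rewrite psumr_eq0 => [/allP Pk|j _]; last exact: sqr_ge0.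
  apply: trmx_inj; rewrite trmx0; apply: inj; first exact: mulmx_qf_eq0.
  apply/matrixP => j l; rewrite ord1 [RHS]mxE; apply/eqP.
  by have := Pk j (mem_index_enum _); rewrite sqrf_eq0.
pose M' := M + r%:R * 4.
pose c := \sum_i \sum_j `|invmx S i j| * ((qf S (delta_mx j 0) + `|M'|) / 2).
have c0 : 0 <= c.
  apply: sumr_ge0 => i _; apply: sumr_ge0 => j _; rewrite mulr_ge0// divr_ge0//.
  by rewrite addr_ge0// qf_ge0.
exists (Num.bound c) => y yM yP.
have SM : qf S (rv y) <= M'.
  rewrite qS lerD// (@le_trans _ _ (\sum_(i < r) 4))//.
    apply: ler_sum => i _; have -> : (4 : R) = 2 ^+ 2 by ring.
    by rewrite -real_normK ?num_real// lerXn2r ?nnegrE.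
  by rewrite sumr_const card_ord mulr_natl.
rewrite mem_int_box; apply/'forall_'forall_idP => i j; rewrite ord1.
rewrite -(ler_nat R); apply: le_trans (ltW (archi_boundP c0)).
have -> : (absz (y i 0))%:R = `|rv y i 0| :> R.
  by rewrite [in RHS]mxE -intr_norm -abszE.
rewrite -[rv y](mulKmx Su) mxE; apply: le_trans (ler_norm_sum _ _ _) _.
rewrite /c [leRHS](bigD1 i)//= -[leLHS]addr0; apply: lerD; last first.
  apply: sumr_ge0 => k _; apply: sumr_ge0 => l _.
  by rewrite mulr_ge0// divr_ge0// addr_ge0// qf_ge0.
apply: ler_sum => k _; rewrite normrM; apply: ler_wpM2l => //.
have -> : (S *m rv y) k 0 = bil S (delta_mx k 0) (rv y).
  by rewrite /bil -mulmxA trmx_delta -rowE [RHS]mxE.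
apply: le_trans (norm_bil_le Spsd _ _) _.
by have := ler_norm M'; lra.
Qed.

(** Rationality of the kernel gives integral kernel vectors along which candidates can be translated
    into a finite box. *)
Lemma minimal_exists Q z : rational_psd Q ->
  exists2 y, minimal Q y & exists w, z = y + w *+ 2.
Proof.
move=> [Qpsd [r [A [Afree /andP[Aker kerA]]]]].
have [d d0 [K KE]] := common_denominator A.
have dR : d%:~R != 0 :> R by rewrite intr_eq0.
have {}KE : (map_mx intr K : 'M[R]_(r, g)) = d%:~R *: map_mx ratr A.
  apply/matrixP => i j; rewrite !mxE.
  have := congr1 (fun X : 'M[rat]_(r, g) => (ratr (X i j) : R)) KE.
  by rewrite !mxE rmorphM/= !ratr_int => ->.
(* [P^T] reads off the coordinates of a kernel vector in the basis [K]. *)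
have /row_freeP[P KP] : row_free (map_mx intr K : 'M[R]_(r, g)).
  by rewrite KE; move: Afree; rewrite /row_free (eqmx_scale _ dR).
have QK : Q *m (map_mx intr K)^T = 0.
  have /sub_kermxP h := Aker; rewrite KE linearZ -scalemxAr.
  by rewrite -[Q]trmxK -trmx_mul h trmx0 scaler0.
have inj (x : 'cV[R]_g) : Q *m x = 0 -> P^T *m x = 0 -> x = 0.
  move=> Qx Px; have : (x^T <= kermx Q^T)%MS.
    by apply/sub_kermxP; rewrite -trmx_mul Qx trmx0.
  move=> /submx_trans/(_ kerA)/submxP[s xs]; apply: trmx_inj; rewrite trmx0 xs.
  have s0 : s = 0; last by rewrite s0 mul0mx.
  have : d%:~R *: (x^T *m P) = s.
    by rewrite xs -mulmxA scalemxAr scalemxAl -KE KP mulmx1.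
  by rewrite -[x^T *m P]trmxK trmx_mul trmxK Px trmx0 scaler0.
(* Subtracting [2 K^T n] preserves the class modulo 2 and the norm, and lowers [P^T y] by [2 n]. *)
have red y : exists2 y', exists w, y' = y + w *+ 2 &
    qf Q (rv y') = qf Q (rv y) /\ forall i, `|(P^T *m rv y') i 0| <= 2.
  pose n : 'cV[int]_r := \col_i Num.floor ((P^T *m rv y) i 0 / 2).
  have KnE : rv (K^T *m n) = (map_mx intr K)^T *m map_mx intr n.
    by rewrite /real_vec map_mxM map_trmx.
  have QKn : Q *m rv (K^T *m n) = 0 by rewrite KnE mulmxA QK mul0mx.
  exists (y + (- (K^T *m n)) *+ 2); first by exists (- (K^T *m n)).
  rewrite real_vecD2 real_vecN; split=> [|i].
    rewrite qfD// qfZ qfN (qf_ker QKn) bilZr bilNr /bil -mulmxA QKn.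
    by rewrite mulmx0 mxE; ring.
  rewrite scalerN mulmxDr mulmxN -scalemxAr KnE mulmxA -trmx_mul KP trmx1 mul1mx.
  rewrite !mxE; set t := \sum_j _.
  by have := floor_itv (t / 2); rewrite rmorphD/= ler_norml => /andP[]; lra.
have [C hC] := sublevel_bound (qf Q (rv z)) Qpsd inj.
pose l := [seq y <- int_box g 1 C | `[< exists w, z = y + w *+ 2 >]].
have memP y w : qf Q (rv y) <= qf Q (rv z) -> z = y + w *+ 2 ->
    exists2 y', y' \in l & qf Q (rv y') = qf Q (rv y).
  move=> yz zE; have [y' [u y'E] [qE Py']] := red y.
  exists y' => //; rewrite mem_filter hC ?qE// andbT; apply/asboolP.
  by exists (w - u); rewrite zE y'E mulrnBl addrACA subrr addr0.
have [z' z'l qz'] : exists2 z', z' \in l & qf Q (rv z') = qf Q (rv z).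
  by apply: (memP z 0) => //; rewrite mul0rn addr0.
have [y yl ymin] := seq_argmin (fun y => qf Q (rv y)) z'l.
exists y; last by move: yl; rewrite mem_filter => /andP[/asboolP].
move=> w; have [wz|/ltW zw] := leP (qf Q (rv (y + w *+ 2))) (qf Q (rv z)).
  move: yl; rewrite mem_filter => /andP[/asboolP[u zE] _].
  have [|y' y'l <-] := memP (y + w *+ 2) (u - w) wz; last exact: ymin.
  by rewrite zE mulrnBl addrACA subrr addr0.
by apply: le_trans zw; rewrite -qz'; exact: ymin.
Qed.

End Minimizers.

(** * Entrywise continuity for matrices *)

Lemma entry_continuous {T : topologicalType} m n i j :
  continuous (fun M : 'M[T]_(m, n) => M i j).
Proof.
move=> M A /= MA; exists (fun k l => [set x | k = i -> l = j -> A x]).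
  move=> k l; have [[-> ->]|kl] := pselect (k = i /\ l = j).
    by apply: filterS MA => x Ax _ _.
  by apply: filterS filterT => x _ ki lj; case: kl.
by move=> N /= /(_ i j erefl erefl).
Qed.

Lemma matrix_continuous {S T : topologicalType} m n (F : S -> 'M[T]_(m, n)) :
  (forall i j, continuous (fun x => F x i j)) -> continuous F.
Proof.
move=> Fc x A [P FP PA]; rewrite /nbhs/=.
have : \forall y \near x, forall i j, P i j (F y i j).
  by apply: filter_forall => i; apply: filter_forall => j; exact: Fc (FP i j).
by apply: filterS => y Py; exact: PA.
Qed.

Section DeloneReduction.
Context {R : realType} {g : nat}.
Implicit Types (Q : 'M[R]_g) (v w y z : 'cV[int]_g) (D : set (set 'cV[R]_g)).
Local Notation rv := (@real_vec R g).

Lemma convex_hull_halfspace n (A : set 'cV[R]_n) (a : 'cV[R]_n) (c : R) :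
  (forall p, A p -> c <= (a^T *m p) 0 0) ->
  forall p, convex_hull A p -> c <= (a^T *m p) 0 0.
Proof.
move=> Aac p; apply: (@smallest_sub _ _ _ [set p | c <= (a^T *m p) 0 0]) => //.
move=> x y l; rewrite !inE /= => cx cy.
have s0 : 0 <= l%:num by [].
have s1 : 0 <= 1 - l%:num by rewrite subr_ge0.
rewrite /conv/= mulmxDr -!scalemxAr mxE [X in X + _]mxE [X in _ + X]mxE.
by have := ler_wpM2l s0 cx; have := ler_wpM2l s1 cy; rewrite /unstable.onem; lra.
Qed.

Definition lift_point Q z : 'cV[R]_(g + 1) :=
  col_mx (rv z) ((rv z)^T *m Q *m rv z).

Lemma lift_point_hull Q z : convex_hull (lifted_lattice Q) (lift_point Q z).
Proof. by apply: sub_gen_smallest; exists z. Qed.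

Lemma tr_mul_lift_point Q z (a : 'cV[R]_(g + 1)) :
  (a^T *m lift_point Q z) 0 0 =
  ((usubmx a)^T *m rv z) 0 0 + dsubmx a 0 0 * qf Q (rv z).
Proof.
rewrite -{1}(vsubmxK a) tr_col_mx mul_row_col mxE; congr (_ + _).
by rewrite mxE big_ord1 mxE.
Qed.

(* Convexity of the quadratic form, in the form of its tangent at [z]. *)
Lemma hull_above Q z p : psd Q -> convex_hull (lifted_lattice Q) p ->
  usubmx p = rv z -> qf Q (rv z) <= dsubmx p 0 0.
Proof.
move=> Qpsd Pp pz; pose a : 'cV[R]_(g + 1) := col_mx (- 2 *: (Q *m rv z)) 1%:M.
have aE q : (a^T *m q) 0 0 = - 2 * bil Q (rv z) (usubmx q) + dsubmx q 0 0.
  rewrite -{1}(vsubmxK q) tr_col_mx mul_row_col mxE trmx1 mul1mx; congr (_ + _).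
  have [sQ _] := Qpsd.
  by rewrite linearZ/= -scalemxAl [LHS]mxE trmx_mul sQ.
have : - qf Q (rv z) <= (a^T *m p) 0 0.
  apply: (convex_hull_halfspace _ Pp) => _ [y /= ->].
  rewrite aE col_mxKu col_mxKd -/(rv y) -/(bil Q (rv y) (rv y)) -/(qf Q (rv y)).
  by have := qf_ge0 Qpsd (rv z - rv y); rewrite qfB//; lra.
by rewrite aE pz -/(qf Q (rv z)); lra.
Qed.

(* [y] is minimal in its class mod 2 iff [0] and [y] lie in a common Delone
   cell: the midpoint of the two lifted points is then on the lower hull. *)
Lemma Del_minimal Q1 Q2 y : psd Q1 -> psd Q2 -> Del Q1 = Del Q2 ->
  minimal Q1 y -> minimal Q2 y.
Proof.
move=> Q1psd Q2psd DelE ymin.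
(* At the lift of [z] this functional is a quarter of [qf (2 z - y) - qf y]: nonnegative by
   minimality, and zero at [0] and [y]. *)
pose a : 'cV[R]_(g + 1) := col_mx (- (Q1 *m rv y)) 1%:M.
have aE z : (a^T *m lift_point Q1 z) 0 0 = qf Q1 (rv z) - bil Q1 (rv y) (rv z).
  rewrite tr_mul_lift_point col_mxKu col_mxKd [1%:M 0 0]mxE mul1r addrC.
  by have [sQ _] := Q1psd; congr (_ + _); rewrite raddfN/= mulNmx [LHS]mxE trmx_mul sQ.
have a_ge0 p : convex_hull (lifted_lattice Q1) p -> 0 <= (a^T *m p) 0 0.
  apply: convex_hull_halfspace => _ [z /= ->].
  rewrite -/(lift_point Q1 z) aE; have := ymin (z - y).
  have -> : rv (y + (z - y) *+ 2) = 2 *: rv z - rv y.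
    rewrite real_vecD2 real_vecB scalerBr scaler_nat mulr2n.
    by apply/matrixP => i j; rewrite !mxE; ring.
  by rewrite qfB// qfZ bilZl (bilC Q1psd (rv z)); lra.
pose F := [set p | convex_hull (lifted_lattice Q1) p /\
  forall q, convex_hull (lifted_lattice Q1) q -> (a^T *m p) 0 0 <= (a^T *m q) 0 0].
have FP z : qf Q1 (rv z) = bil Q1 (rv y) (rv z) -> F (lift_point Q1 z).
  move=> zE; split; first exact: lift_point_hull.
  by move=> q /a_ge0; rewrite aE zE subrr.
have F0 : F (lift_point Q1 0) by apply: FP; rewrite real_vec0 qf0 bil0r.
have Fy : F (lift_point Q1 y) by apply: FP.
have : Del Q2 (usubmx @` F).
  rewrite -DelE; exists F => //; split; first by exists (lift_point Q1 0).
  by exists a => //; rewrite col_mxKd [1%:M 0 0]mxE.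
move=> [G [_ [b b0 GE]] FG].
have proj z : F (lift_point Q1 z) -> exists2 p, G p & usubmx p = rv z.
  move=> Fz; have : (usubmx @` F) (rv z).
    by exists (lift_point Q1 z) => //; rewrite col_mxKu.
  by rewrite FG => -[p Gp pE]; exists p.
have [p0 + p0E] := proj _ F0; rewrite GE => -[P0 min0].
have [py + pyE] := proj _ Fy; rewrite GE => -[Py miny].
pose L z := ((usubmx b)^T *m rv z) 0 0.
have bE (p : 'cV[R]_(g + 1)) : (b^T *m p) 0 0 =
    ((usubmx b)^T *m usubmx p) 0 0 + dsubmx b 0 0 * dsubmx p 0 0.
  rewrite -{1}(vsubmxK b) -{1}(vsubmxK p) tr_col_mx mul_row_col mxE.
  by congr (_ + _); rewrite mxE big_ord1 mxE.
have LD z z' : L (z + z') = L z + L z' by rewrite /L real_vecD mulmxDr mxE.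
have p0_ge0 : 0 <= (b^T *m p0) 0 0.
  rewrite bE p0E real_vec0 mulmx0 mxE add0r mulr_ge0 ?(ltW b0)//.
  by have := hull_above Q2psd P0 p0E; rewrite real_vec0 qf0.
have L_ge0 z : 0 <= L z + dsubmx b 0 0 * qf Q2 (rv z).
  rewrite /L -tr_mul_lift_point; apply: le_trans p0_ge0 _.
  by apply: min0; exact: lift_point_hull.
have L_le0 : L y + dsubmx b 0 0 * qf Q2 (rv y) <= 0.
  have : (b^T *m py) 0 0 <= 0.
    have := miny _ (lift_point_hull 0).
    by rewrite tr_mul_lift_point real_vec0 qf0 mulr0 mulmx0 [X in _ <= X + _]mxE add0r.
  apply: le_trans; rewrite bE pyE lerD2l ler_pM2l//.
  exact: hull_above pyE.
(* Adding the inequalities at [y + w] and [- w] cancels the linear term [L w]. *)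
move=> w; have := L_ge0 (y + w); have := L_ge0 (- w).
have -> : L (- w) = - L w.
  by apply/eqP; rewrite -addr_eq0 -LD addNr /L real_vec0 mulmx0 mxE.
rewrite LD real_vecD2 real_vecN real_vecD qfN !qfD// qfZ bilZr => h1 h2.
have : 0 <= dsubmx b 0 0 * (2 * bil Q2 (rv y) (rv w) + 2 * qf Q2 (rv w)).
  by move: h1 h2 L_le0; rewrite !mulrDr; lra.
by rewrite pmulr_rge0//; lra.
Qed.

Lemma bil_continuous (u v : 'cV[R]_g) : continuous (fun Q : 'M[R]_g => bil Q u v).
Proof.
have -> : (fun Q : 'M[R]_g => bil Q u v) =
    (fun Q : 'M[R]_g => \sum_j (\sum_i u i 0 * Q i j) * v j 0).
  apply/funext => Q; rewrite /bil mxE; apply: eq_bigr => j _; rewrite mxE.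
  by congr (_ * _); apply: eq_bigr => i _; rewrite mxE.
apply: continuous_big => [|j _]; first exact: add_continuous.
have H : continuous (fun Q : 'M[R]_g => \sum_i u i 0 * Q i j).
  apply: continuous_big => [|i _ Q]; first exact: add_continuous.
  by apply: (cvgMl_tmp (F := nbhs Q)); exact: entry_continuous.
by move=> Q; apply: (cvgMr_tmp (F := nbhs Q)); exact: H.
Qed.

Lemma closure_ge0 (A : set 'M[R]_g) (h : 'M[R]_g -> R) : continuous h ->
  (forall Q, A Q -> 0 <= h Q) -> forall Q, closure A Q -> 0 <= h Q.
Proof.
move=> hc hA Q; rewrite closureE.
apply: (@smallest_sub _ _ _ [set Q | 0 <= h Q]) => //.
apply: (@closed_comp _ _ h [set x | 0 <= x]); last exact: closed_ge.
by move=> x _; exact: hc.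
Qed.

Lemma closure_psd (A : set 'M[R]_g) : (forall Q, A Q -> psd Q) ->
  forall Q, closure A Q -> psd Q.
Proof.
move=> Apsd Q clQ; split; last first.
  move=> x; apply: (@closure_ge0 A (fun P => bil P x x) _ _ Q clQ).
    exact: bil_continuous.
  move=> P /Apsd[_].
  exact.
suff H i j : 0 <= Q i j - Q j i.
  apply/matrixP => i j; rewrite mxE; apply/eqP; rewrite eq_le -subr_ge0 H.
  by rewrite -subr_ge0 H.
apply: (@closure_ge0 A (fun Q => Q i j - Q j i) _ _ Q clQ).
  by move=> P; apply: (cvgB (F := nbhs P)); exact: entry_continuous.
by move=> P /Apsd[sP _]; rewrite -{1}sP mxE subrr.
Qed.

Lemma closure_minimal (A : set 'M[R]_g) y : (forall Q, A Q -> minimal Q y) ->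
  forall Q, closure A Q -> minimal Q y.
Proof.
move=> Amin Q clQ w; rewrite -subr_ge0.
apply: (@closure_ge0 A (fun Q => qf Q (rv (y + w *+ 2)) - qf Q (rv y)) _ _ Q clQ).
  by move=> P; apply: (cvgB (F := nbhs P)); exact: bil_continuous.
by move=> P /Amin; rewrite subr_ge0; apply.
Qed.

(** Minimal vectors chosen for one form of [sigma D], one for each 0-1 vector, serve all of
    [sigma D] by [Del_minimal] and its closure by [closure_minimal]. *)
Lemma secondary_cone_reduced D :
  exists B, forall Q, secondary_cone D Q -> reduced B Q.
Proof.
have [[Q1 [Q1r DE]]|noQ] := pselect (exists Q, sigma D Q); last first.
  exists 0%N => Q clQ; suff : closure set0 Q by rewrite closure0.
  by apply: closureS clQ => P DP; case: noQ; exists P.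
have /choice[y hy] : forall c : 'cV['I_2]_g, exists y : 'cV[int]_g,
    minimal Q1 y /\ exists w, map_mx (fun i : 'I_2 => (i : nat)%:Z) c = y + w *+ 2.
  move=> c.
  have [y] := minimal_exists (map_mx (fun i : 'I_2 => (i : nat)%:Z) c) Q1r.
  by exists y.
exists (\max_c \max_i absz (y c i 0%R)) => Q clQ; split.
  by apply: closure_psd clQ => P [[]].
move=> z; pose c : 'cV['I_2]_g := \col_i inord (absz (z i 0%R %% 2)%Z).
exists (y c).
  rewrite mem_int_box; apply/'forall_'forall_idP => i j; rewrite ord1.
  apply: leq_trans (leq_bigmax c).
  exact: (leq_bigmax (F := fun i => absz (y c i 0%R)) i).
have [ymin [w wE]] := hy c; split.
  apply: closure_minimal clQ => P [[Ppsd _] PD].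
  by apply: Del_minimal ymin; rewrite ?PD//; have [] := Q1r.
exists (w + \col_i (z i 0%R %/ 2)%Z); rewrite mulrnDl addrA -wE.
apply/matrixP => i j; rewrite ord1 !(mulmxnE, mxE) inordK; lia.
Qed.

End DeloneReduction.

(** * Separation in the quotient *)

Section Separation.
Context {T : topologicalType}.

Lemma matrix_hausdorff m n : hausdorff_space T -> hausdorff_space 'M[T]_(m, n).
Proof.
move=> hT M N clMN; apply/matrixP => i j; apply: hT => A B MA NB.
have := clMN ((fun P : 'M[T]_(m, n) => P i j) @^-1` A)
  ((fun P : 'M[T]_(m, n) => P i j) @^-1` B).
by case=> [||P [PA PB]]; [exact: entry_continuous..|exists (P i j)].
Qed.

Lemma open_seq_bigcap {I : eqType} (s : seq I) (F : I -> set T) :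
  (forall i, i \in s -> open (F i)) ->
  open [set x | forall i, i \in s -> F i x].
Proof.
elim: s => [_|i s IHs oF].
  have -> : [set x | forall i : I, i \in [::] -> F i x] = setT.
    by apply/seteqP; split.
  exact: openT.
have -> : [set x | forall j, j \in i :: s -> F j x] =
    F i `&` [set x | forall j, j \in s -> F j x]; last first.
  apply: openI; first by apply: oF; exact: mem_head.
  by apply: IHs => j js; apply: oF; rewrite inE js orbT.
apply/seteqP; split=> [x h|x [Fx h] j]; last first.
  by rewrite inE => /predU1P[->//|]; exact: h.
by split=> [|j js]; apply: h; rewrite inE ?eqxx// js orbT.
Qed.

(** A new point [a] is separated from each [b]; finitely many neighbourhoods of [a] are intersected,
    those of the [b] united. *)
Lemma seq_separation (A B : seq T) : hausdorff_space T ->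
  (forall a b, a \in A -> b \in B -> a != b) ->
  exists UV : set T * set T, [/\ open UV.1, open UV.2,
    forall a, a \in A -> UV.1 a, forall b, b \in B -> UV.2 b &
    UV.1 `&` UV.2 = set0].
Proof.
rewrite open_hausdorff => hT; elim: A => [|a A IHA] AB.
  exists (set0, setT); split=> //=; [exact: open0|exact: openT|exact: set0I].
have [|[U V] /= [Uo Vo AU BV UV0]] := IHA.
  by move=> x b xA; apply: AB; rewrite inE xA orbT.
have /choice[f hf] : forall b, exists W : set T * set T, b \in B ->
    [/\ open W.1, open W.2, W.1 a, W.2 b & W.1 `&` W.2 = set0].
  move=> b; have [bB|_] := boolP (b \in B); last by exists (set0, set0).
  have := hT a b (AB _ _ (mem_head _ _) bB).
  case=> W [aW bW] [open1 open2 /eqP W0].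
  by exists W => _; split=> //; exact: set_mem.
pose N := [set x | forall b, b \in B -> (f b).1 x].
pose M := [set x | exists2 b, b \in B & (f b).2 x].
exists (U `|` N, V `&` M); split=> /=.
- by apply: openU => //; apply: open_seq_bigcap => b /hf[].
- apply: openI => //; rewrite (_ : M = \bigcup_(b in [set b | b \in B]) (f b).2).
    by apply: bigcup_open => b /hf[].
  by apply/seteqP; split=> x [b bB Wb]; exists b.
- by move=> x; rewrite inE => /predU1P[->|/AU ?]; [right=> b /hf[]|left].
- by move=> b bB; split; [exact: BV|exists b => //; have [] := hf b bB].
- apply/seteqP; split=> // x [[Ux|Nx] [Vx [b bB Wx]]].
    by have : (U `&` V) x by []; rewrite UV0.
  have [_ _ _ _ W0] := hf b bB.
  have : ((f b).1 `&` (f b).2) x by split=> //; exact: Nx.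
  by rewrite W0.
Qed.

End Separation.

Lemma act_continuous {R : realType} {g : nat} (Z : 'M[int]_g) :
  continuous (act Z : 'M[R]_g -> 'M[R]_g).
Proof.
apply: matrix_continuous => i j.
rewrite (_ : (fun _ => _) = fun Q : 'M[R]_g =>
  bil Q (real_vec (col i Z)) (real_vec (col j Z))).
  exact: bil_continuous.
apply/funext => Q; rewrite /bil /act /real_vec !map_col !colE trmx_mul.
by rewrite trmx_delta -!mulmxA -rowE mulmxA mulmxA mulmxA -colE !mxE.
Qed.

(** * Classes of forms and saturated open sets *)

Section AtrClasses.
Context {R : realType} {g k : nat} (D : 'I_k -> set (set 'cV[R]_g)).
Local Notation cone i := (set_type (secondary_cone (D i))).

Definition atr_class i (Q : cone i) : Atr D :=
  (\pi_(Atr D) (existT _ i (cone_class Q) : cone_union D))%qT.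

Lemma atr_class_surj (p : Atr D) : exists i (Q : cone i), atr_class Q = p.
Proof.
rewrite -[p]reprK; case: (repr p) => i c; have [Q <-] := cone_class_surj c.
by exists i, Q.
Qed.

(** The two-stage quotient collapses to one equivalence: stabilizer elements are absorbed into
    [X]. *)
Lemma atr_class_eq i j (Q : cone i) (Q' : cone j) :
  atr_class Q = atr_class Q' <->
  exists2 X, GLZ X & val Q' = act X (val Q).
Proof.
split=> [e|[X Xu e]]; last first.
  apply: (elimT (eqmodP (atr_equiv D) _ _)); apply/asboolP.
  by exists Q, Q'; split=> //; exists X.
have /asboolP[/= P [P' [eP eP' [X Xu XE]]]] :=
  introT (eqmodP (atr_equiv D) _ _) e.
have [Y [Yu _] YE] := cone_class_eq eP.
have [Z [Zu _] ZE] := cone_class_eq (esym eP').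
exists (Y *m (X *m Z)); last by rewrite !actM -YE -XE -ZE.
by rewrite /GLZ/= !unitmx_mul Yu Xu.
Qed.

(** The complement of the image of the complement of [O]; its openness says that saturations of
    closed sets are closed. *)
Definition saturated_interior (O : set 'M[R]_g) : set (Atr D) :=
  [set p | forall i (Q : cone i), atr_class Q = p -> O (val Q)].

Lemma atr_act_finite : exists2 L : seq 'M[int]_g, (forall Z, Z \in L -> GLZ Z) &
  forall i j (Q : cone i) (Q' : cone j), atr_class Q = atr_class Q' ->
    exists2 Z, Z \in L & val Q' = act Z (val Q).
Proof.
have /choice[B hB] := fun i => secondary_cone_reduced (D i).
have red i (Q : cone i) : reduced (\max_j B j) (val Q).
  by apply: (reducedS (leq_bigmax i)); apply: hB; exact: set_valP.
have [L Lu hL] := @act_finite R g (\max_j B j).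
exists L => // i j Q Q' /atr_class_eq[X Xu XE].
have [|Z ZL ZE] := hL (val Q) X (red _ Q) Xu; first by rewrite -XE; exact: red.
by exists Z; rewrite // XE ZE.
Qed.

Lemma open_saturated_interior (O : set 'M[R]_g) : open O ->
  open (saturated_interior O).
Proof.
move=> oO; have [L Lu hL] := atr_act_finite.
(* Open because the cones are closed and finitely many; [W] asks this of the finitely many
   translates by [L]. *)
pose C := [set Q | forall i, i \in enum 'I_k ->
  (~` secondary_cone (D i) `|` O) Q].
have oC : open C.
  apply: open_seq_bigcap => i _; apply: openU => //.
  by apply: closed_openC; exact: closed_closure.
pose W := [set Q : 'M[R]_g | forall Z, Z \in L -> C (act Z Q)].
have oW : open W.
  apply: (@open_seq_bigcap _ _ L (fun Z => act Z @^-1` C)) => Z _.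
  by apply: open_comp => // Q _; exact: act_continuous.
(* Openness in the quotients, the disjoint union and the subspace unfolds to an open set of matrices
   cutting out the right forms of each cone. *)
apply/sigT_openP => i; exists W => //; apply/seteqP; split=> Q /=.
  move=> WQ j Q' e; have [Z ZL ZE] := hL _ _ _ _ (esym e).
  rewrite ZE; have [|//] := WQ Z ZL j (mem_enum _ _).
  by case; rewrite -ZE; exact: set_valP.
move=> satQ Z ZL j _; have [Dj|] := pselect (secondary_cone (D j) (act Z (val Q))).
  right; apply: (satQ j (exist _ (act Z (val Q)) (mem_set Dj))).
  by apply/esym/atr_class_eq; exists Z; first exact: Lu.
by left.
Qed.

End AtrClasses.

Theorem theorem4p13 (R : realType) (g : nat) (hg : (1 <= g)%N) (k : nat)
    (D : 'I_k -> set (set 'cV[R]_g)) (hD : orbit_representatives D) :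
  hausdorff_space (Atr D).
Proof.
rewrite open_hausdorff => p q pq; have [L Lu hL] := atr_act_finite D.
have [i [P pE]] := atr_class_surj p; have [j [Q qE]] := atr_class_surj q.
(* The translates of [P] by [L] include every form representing [p]; one shared with [Q] would force
   [p = q]. *)
have [|a b /mapP[Z ZL ->] /mapP[Y YL ->]|] := @seq_separation 'M[R]_g
  [seq act Z (val P) | Z <- L] [seq act Z (val Q) | Z <- L].
- by apply: matrix_hausdorff; exact: Rhausdorff.
- apply: contra_neq pq => ZY; rewrite -pE -qE; apply/atr_class_eq.
  exists (Z *m invmx Y).
    by rewrite /GLZ/= unitmx_mul unitmx_inv (Lu Z ZL : _ \in _) (Lu Y YL : _ \in _).
  by rewrite actM ZY actK//; exact: Lu.
move=> [U V] /= [Uo Vo PU QV UV0].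
exists (saturated_interior U, saturated_interior V); split=> /=.
- by apply/mem_set => l S SE; have [Z ZL ->] := hL _ _ _ _ (etrans pE (esym SE));
    apply: PU; exact: map_f.
- by apply/mem_set => l S SE; have [Z ZL ->] := hL _ _ _ _ (etrans qE (esym SE));
    apply: QV; exact: map_f.
- exact: open_saturated_interior.
- exact: open_saturated_interior.
- apply/eqP/seteqP; split=> // r [rU rV]; have [l [S SE]] := atr_class_surj r.
  have : (U `&` V) (val S) by split; [exact: rU SE|exact: rV SE].
  by rewrite UV0.
Qed.
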